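(* Let $I$ be a non-degenerate real interval, and let $(M_n)_{n\ge 1}$, $M_n:I^n\to I$, be a family of symmetric means on $I$, with $M_1=\mathrm{id}$. Assume that each $M_n$ is strictly increasing in each variable and that the family satisfies the replacement axiom. Then there exist a non-degenerate real interval $J$ and a continuous strictly monotone bijection $\varphi:I\to J$ such that \[ M_n(x_1,\dots,x_n)=\varphi^{-1}\!\left(\frac{\varphi(x_1)+\cdots+\varphi(x_n)}{n}\right) \] for every $n\ge 1$ and all $x_1,\dots,x_n\in I$. In particular, all the means $M_n$ are continuous.
   Context: A map $M:I^n\to I$ is a mean if $\min_i x_i\le M(x_1,\dots,x_n)\le \max_i x_i$ for all $x_1,\dots,x_n\in I$. It is symmetric if its value is invariant under all permutations of its arguments. It is strictly increasing in each variable if for every $j$ and every choice of the remaining variables, the section in the $j$-th variable is strictly increasing on $I$. A family of means $(M_n)_{n\ge1}$ with $M_n:I^n\to I$ and $M_1=\mathrm{id}$ satisfies the replacement axiom if for all integers $k,m\ge 1$ and all $x_1,\dots,x_k,y_1,\dots,y_m\in I$, \[ M_{k+m}(x_1,\dots,x_k,y_1,\dots,y_m)=M_{k+m}\bigl(\underbrace{M_k(x_1,\dots,x_k),\dots,M_k(x_1,\dots,x_k)}_{k},y_1,\dots,y_m\bigr). \] An interval is non-degenerate if it contains more than one point. *)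

(* Defs.v *)
From mathcomp Require Export all_boot all_order all_fingroup all_algebra.
From mathcomp Require Export all_classical all_reals all_analysis.

Export Order.TTheory GRing.Theory Num.Theory.
Export numFieldNormedType.Exports.

Local Open Scope classical_set_scope.
Local Open Scope ring_scope.

Section Means.
Context {R : realType}.
Implicit Types (I : set R) (n : nat).

Definition nondegenerate I := exists x y, [/\ I x, I y & x != y].

Definition cube I n : set 'rV[R]_n := [set x | forall i, I (x ord0 i)].

(* The index [i0] witnesses n >= 1. Seeding the iterated minimum (maximum) with
   the coordinate x_i0, which is itself among the terms, makes it min_i x_i
   (max_i x_i). *)
Definition is_mean I {n} (M : 'rV[R]_n -> R) : Prop :=
  set_fun (cube I n) I M /\
  forall x, cube I n x -> forall i0 : 'I_n,
    \big[Num.min/x ord0 i0]_(i < n) x ord0 i <= M x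
      <= \big[Num.max/x ord0 i0]_(i < n) x ord0 i.

Definition symmetric_on I {n} (M : 'rV[R]_n -> R) : Prop :=
  forall x, cube I n x -> forall s : 'S_n, M (col_perm s x) = M x.

Definition replace_coord {n} (x : 'rV[R]_n) (j : 'I_n) (t : R) : 'rV[R]_n :=
  \row_i (if i == j then t else x ord0 i).

Definition strictly_increasing_each I {n} (M : 'rV[R]_n -> R) : Prop :=
  forall x, cube I n x -> forall j : 'I_n,
    {in I &, {homo (fun t => M (replace_coord x j t)) : a b / a < b}}.

Definition replacement_axiom I (M : forall n, 'rV[R]_n -> R) : Prop :=
  forall k m, (0 < k)%N -> (0 < m)%N ->
  forall (x : 'rV[R]_k) (y : 'rV[R]_m), cube I k x -> cube I m y ->
    M (k + m)%N (row_mx x y) = M (k + m)%N (row_mx (const_mx (M k x)) y).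

Definition strictly_monotone_on I (f : R -> R) : Prop :=
  {in I &, {homo f : a b / a < b}} \/ {in I &, {homo f : a b / a < b >-> b < a}}.

End Means.

(* Main.v *)
Require Import Defs.
From mathcomp Require Import zify ring lra.

(** Replacement and strict monotonicity say that comparing the means of two
    lists of the same length is a cancellative total preorder, compatible with
    concatenation. It therefore comes from a totally preordered abelian group:
    the formal integer combinations of points of [I] of total degree 0, where
    [s - t] is nonnegative when the mean of [s] is at least that of [t]. In
    this group a list [s] of length [n] is equivalent to [n] copies of its
    mean. Hence an additive map [F] to the reals that is monotone, and positive
    on [y - x] whenever [x < y], solves the problem: [phi x := F (x - a)], for
    a fixed [a] in [I], is strictly increasing and the sum of [phi] over [s]
    is [n] times the value of [phi] at the mean. Such an [F] is given by the
    argument of Hoelder's theorem on archimedean ordered groups ([hoelder]).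

    The heart of the proof is thus that the group is archimedean
    ([archimedean]); this replaces the usual continuity hypothesis. Suppose
    that [y - x > 0] is infinitesimal relative to [v - u > 0]. Measuring the
    elements bounded by multiples of [v - u] against that unit gives a coarser
    additive map [F], which vanishes on [y - x]. The function
    [z |-> F (z - u)] is nondecreasing from [u, v] to the reals, and its image
    contains 0 and 1 and is closed under midpoints, because means exist; so it
    takes every value of [0, 1]. Choosing [c t] with value [t], the intervals
    from the mean of [c t, x] to the mean of [c t, y] are nonempty, and
    pairwise disjoint because [c t' - c t] exceeds [y - x] for [t < t'].
    Uncountably many disjoint open intervals do not exist on the real line.

    Continuity comes last and for free: [phi (I)] is closed under midpoints,
    hence an interval, and a monotone function whose image is an interval is
    continuous. The same applies to the inverse of [phi], and so the means are
    continuous as compositions. *)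

Local Open Scope classical_set_scope.
Local Open Scope ring_scope.

(** * Real-valued additive maps on preordered abelian groups with an order unit *)

(** The ordered group is the part [D] of [V], with nonnegative cone [N] and an
    order unit [e]. Nonnegative elements may be infinitesimal with respect to
    [e]: the resulting map is monotone but may vanish on them. *)
Section Hoelder.
Local Set Implicit Arguments.
Local Unset Strict Implicit.
Context {R : realType} {V : zmodType} {D N : V -> Prop} {e : V}.
Context (D_e : D e) (D_opp : forall f, D f -> D (- f))
  (D_add : forall f g, D f -> D g -> D (f + g)).
Context (N_add : forall f g, N f -> N g -> N (f + g))
  (N_total : forall f, D f -> N f \/ N (- f)).
Context (e_pos : ~ N (- e)) (e_unit : forall f, D f -> exists n, N (e *+ n - f)).

Let N0 : N 0.
Proof.
have D0 : D 0 by rewrite -(subrr e); apply/D_add/D_opp.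
by case: (N_total D0) => //; rewrite oppr0.
Qed.

Let N_muln f n : N f -> N (f *+ n).
Proof. by move=> Nf; elim: n => [|n IH]; rewrite ?mulr0n// mulrS; exact: N_add. Qed.

Let D_muln f n : D f -> D (f *+ n).
Proof.
move=> Df; elim: n => [|n IH]; last by rewrite mulrS; exact: D_add.
by rewrite mulr0n -(subrr e); apply/D_add/D_opp.
Qed.

Let D_mulz f k : D f -> D (f *~ k).
Proof.
move=> Df; case: k => n; first exact: D_muln.
by rewrite NegzE mulrNz; apply/D_opp/D_muln.
Qed.

Let N_e : N e. Proof. by case: (N_total D_e). Qed.

(** The rationals [r] with [r e <= f]; cross-multiplication avoids dividing in
    the group. *)
Definition lower_fractions f : set R :=
  [set r | exists (p : int) (q : nat),
     [/\ (0 < q)%N, r = p%:~R / q%:R & N (f *+ q - e *~ p)]].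

Definition archimedean_ratio f : R := sup (lower_fractions f).

(** If [p e <= q f] and [q' f <= p' e] then [p q' e <= p' q e], and a negative
    difference of these integers would make [- e] nonnegative. So lower
    fractions of [f] lie below upper ones; being total, the preorder puts every
    rational on one of the two sides, and [f] determines a Dedekind cut. *)
Let fraction_le f (p p' : int) (q q' : nat) : (0 < q)%N -> (0 < q')%N ->
  N (f *+ q - e *~ p) -> N (e *~ p' - f *+ q') ->
  p%:~R / q%:R <= p'%:~R / q'%:R :> R.
Proof.
move=> q0 q0' Np Np'.
have {Np Np'} : N (e *~ (p' * q - p * q')).
  have := N_add (N_muln q' Np) (N_muln q Np').
  rewrite !mulrnBl -!mulrnA [(q' * q)%N]mulnC addrC addrA subrK.
  by rewrite mulrzBr !pmulrn -!mulrzA.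
move=> Ne; rewrite ler_pdivrMr ?ltr0n// mulrAC ler_pdivlMr ?ltr0n//.
rewrite !pmulrn -!intrM ler_int leNgt; apply/negP => lt_pq; apply: e_pos.
have [n En] : exists n : nat, (p * q' - p' * q)%R = n.+1%:Z.
  by exists `|(p * q' - p' * q)%R|%N.-1; lia.
have := N_add Ne (N_muln n N_e).
by rewrite -[_ * _ - _]opprB En mulrNz -pmulrn mulrS opprD addrNK.
Qed.

Let lower_or_upper f (p : int) (q : nat) : D f ->
  N (f *+ q - e *~ p) \/ N (e *~ p - f *+ q).
Proof.
move=> Df; rewrite -[e *~ p - _]opprB; apply: N_total.
by apply: D_add; [exact: D_muln|apply/D_opp/D_mulz].
Qed.

Let has_sup_lower f : D f -> has_sup (lower_fractions f).
Proof.
move=> Df; split.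
  have [n Nn] := e_unit (D_opp Df); exists ((- n%:Z)%:~R / 1%:R), (- n%:Z), 1%N.
  by split=> //; rewrite mulrNz opprK addrC; move: Nn; rewrite opprK -pmulrn.
have [n Nn] := e_unit Df; exists (n%:Z%:~R / 1%:R) => _ [p [q [q0 -> Np]]].
by apply: (fraction_le (f := f)) => //; rewrite -pmulrn.
Qed.

Let ratio_ge f p q : D f -> (0 < q)%N -> N (f *+ q - e *~ p) ->
  p%:~R / q%:R <= archimedean_ratio f.
Proof.
move=> Df q0 Np; apply: sup_upper_bound; first exact: has_sup_lower.
by exists p, q.
Qed.

Let ratio_le f p q : D f -> (0 < q)%N -> N (e *~ p - f *+ q) ->
  archimedean_ratio f <= p%:~R / q%:R.
Proof.
move=> Df q0 Np; apply: ge_sup => [|_ [p' [q' [q0' -> Np']]]].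
  exact: (has_sup_lower Df).1.
exact: fraction_le Np.
Qed.

(** Lower fractions add up to lower fractions, which gives superadditivity.
    Equality then follows from [ratio_opp], as [f = (f + g) + (- g)]. *)
Let ratio_addr_ge f g : D f -> D g ->
  archimedean_ratio f + archimedean_ratio g <= archimedean_ratio (f + g).
Proof.
move=> Df Dg; rewrite -lerBrDr; apply: ge_sup => [|_ [p [q [q0 -> Np]]]].
  exact: (has_sup_lower Df).1.
rewrite lerBrDr -lerBrDl; apply: ge_sup => [|_ [p' [q' [q0' -> Np']]]].
  exact: (has_sup_lower Dg).1.
rewrite lerBrDl addf_div ?pnatr_eq0 -?lt0n//.
have -> : p%:~R * q'%:R + p'%:~R * q%:R = (p * q' + p' * q)%:~R :> R.
  by rewrite intrD !intrM !pmulrn.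
rewrite -natrM; apply: ratio_ge; rewrite ?muln_gt0 ?q0//; first exact: D_add.
have := N_add (N_muln q' Np) (N_muln q Np').
rewrite !mulrnBl -!mulrnA [(q' * q)%N]mulnC addrACA -mulrnDl -opprD.
by rewrite mulrzDr !pmulrn -!mulrzA.
Qed.

Let ratio0 : archimedean_ratio 0 = 0.
Proof.
have D0 : D 0 by rewrite -(subrr e); apply/D_add/D_opp.
apply/le_anti/andP; split.
  by have := @ratio_le 0 0 1%N D0 isT; rewrite mul0r; apply; rewrite mulr0z subr0.
by have := @ratio_ge 0 0 1%N D0 isT; rewrite mul0r; apply; rewrite mulr0z subr0.
Qed.

(** One inequality is superadditivity. If the other failed, a rational [r] would
    lie strictly between the ratio of [f] and the opposite of that of [- f];
    then [r] is not a lower fraction of [f], and it is not an upper one either,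
    for [- r] would be a lower fraction of [- f]. *)
Let ratio_opp f : D f -> archimedean_ratio (- f) = - archimedean_ratio f.
Proof.
move=> Df; apply/le_anti/andP; split.
  by have := ratio_addr_ge Df (D_opp Df); rewrite subrr ratio0 -lerBrDl sub0r.
rewrite lerNl leNgt; apply/negP => /rat_in_itvoo[r].
rewrite in_itv/= => /andP[ltr rlt].
have Er : ratr r = (numq r)%:~R / `|denq r|%N%:R :> R.
  by rewrite {1}/ratr natr_absz ger0_norm ?denq_ge0.
have d0 : (0 < `|denq r|)%N by rewrite absz_gt0 denq_neq0.
case: (lower_or_upper (numq r) `|denq r|%N Df) => Nr.
  by have := ratio_ge Df d0 Nr; rewrite -Er leNgt ltr.
have := @ratio_ge (- f) (- numq r) `|denq r|%N (D_opp Df) d0.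
rewrite mulrNz opprK mulNrn addrC => /(_ Nr).
by rewrite mulrNz mulNr -Er lerNl leNgt rlt.
Qed.

Let ratio_add f g : D f -> D g ->
  archimedean_ratio (f + g) = archimedean_ratio f + archimedean_ratio g.
Proof.
move=> Df Dg; apply/le_anti; rewrite ratio_addr_ge// andbT.
have := ratio_addr_ge (D_add Df Dg) (D_opp Dg).
by rewrite addrK ratio_opp// lerBlDr.
Qed.

Lemma hoelder : exists F : V -> R,
  [/\ forall f g, D f -> D g -> F (f + g) = F f + F g,
      forall f, D f -> F (- f) = - F f,
      forall f n, D f -> F (f *+ n) = F f *+ n,
      forall f, D f -> N f -> 0 <= F f
    & F e = 1].
Proof.
exists archimedean_ratio; split.
- exact: ratio_add.
- exact: ratio_opp.
- move=> f n Df; elim: n => [|n IH]; first by rewrite !mulr0n ratio0.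
  by rewrite !mulrS ratio_add ?IH//; exact: D_muln.
- move=> f Df Nf; have := @ratio_ge f 0 1%N Df isT; rewrite mul0r; apply.
  by rewrite mulr0z subr0.
apply/le_anti/andP; split.
  by have := @ratio_le e 1 1%N D_e isT; rewrite divr1; apply; rewrite subrr.
by have := @ratio_ge e 1 1%N D_e isT; rewrite divr1; apply; rewrite subrr.
Qed.

End Hoelder.

(** * Monotone functions on an interval *)

Section MonotoneFunctions.
Context {R : realType} {I : set R} {h : R -> R}.
Context (h_le : {in I &, {homo h : x y / x <= y}}).

Local Set Implicit Arguments.
Local Unset Strict Implicit.

Let h_lt x y : I x -> I y -> h x < h y -> x < y.
Proof.
move=> Ix Iy; rewrite !ltNge; apply: contra => ?.
by apply: h_le; rewrite ?inE.
Qed.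

(** At a point [c], the image of [I] reaches values above [h c] that are as
    close to [h c] as wanted, unless [h c] is the maximum; by monotonicity such
    a value bounds [h] on a whole neighbourhood of [c]. Likewise from below. *)
Lemma interval_image_continuous : is_interval (h @` I) -> {within I, continuous h}.
Proof.
move=> hI_itv; apply/subspace_continuousP => c Ic; apply/cvgrPdist_lt => e e0.
have near_above : \forall z \near within I (nbhs c), h z < h c + e.
  have [[y Iy cy]|top] := pselect (exists2 y, I y & h c < h y); last first.
    apply: filterS (withinT _ _) => z Iz /=; rewrite -subr_gt0.
    have : h z <= h c by rewrite leNgt; apply/negP => ?; apply: top; exists z.
    by lra.
  have [y' Iy' hy'] : (h @` I) (Num.min (h y) (h c + e / 2)).
    apply: (hI_itv (h c) (h y)); [by exists c|by exists y|].
    by rewrite ge_min lexx/= le_min ltW//; lra.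
  have cy' : c < y'.
    by apply: h_lt => //; rewrite hy' lt_min cy/=; lra.
  apply: filterS2 (withinT _ _) (cvg_within _ (lt_nbhsl cy')) => z Iz zy'.
  have : h z <= h y' by apply: h_le; rewrite ?inE// ltW.
  by rewrite hy' le_min => /andP[_]; lra.
have near_below : \forall z \near within I (nbhs c), h c - e < h z.
  have [[y Iy cy]|bot] := pselect (exists2 y, I y & h y < h c); last first.
    apply: filterS (withinT _ _) => z Iz /=.
    have : h c <= h z by rewrite leNgt; apply/negP => ?; apply: bot; exists z.
    by lra.
  have [y' Iy' hy'] : (h @` I) (Num.max (h y) (h c - e / 2)).
    apply: (hI_itv (h y) (h c)); [by exists y|by exists c|].
    by rewrite le_max lexx/= ge_max (ltW cy)/=; lra.
  have cy' : y' < c.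
    by apply: h_lt => //; rewrite hy' gt_max cy/=; lra.
  apply: filterS2 (withinT _ _) (cvg_within _ (lt_nbhsr cy')) => z Iz zy'.
  have : h y' <= h z by apply: h_le; rewrite ?inE// ltW.
  by rewrite hy' ge_max => /andP[_]; lra.
apply: filterS2 near_above near_below => z zlt zgt.
by rewrite ltr_norml /from_subspace; apply/andP; split; lra.
Qed.

Context (h_mid : forall x y, I x -> I y ->
  exists2 z, I z & h z = (h x + h y) / 2).

(** Bisection: replacing an endpoint of a pair of values around [p] by their
    midpoint halves the gap, until it fits between [p] and [q]. *)
Lemma midpoint_image_dense x y p q :
  I x -> I y -> h x <= p < h y -> p < q -> exists2 z, I z & p < h z < q.
Proof.
move=> Ix Iy pxy ltpq.
have bisect n : exists u v, [/\ I u, I v, h u <= p < h v &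
    (h v - h u) * 2 ^+ n <= h y - h x].
  elim: n => [|n [u [v [Iu Iv puv len]]]]; first by exists x, y; rewrite mulr1.
  have [w Iw hw] := h_mid Iu Iv; rewrite exprS.
  have [wp|pw] := leP (h w) p.
    by exists w, v; split=> //; [lra|apply: le_trans len; rewrite hw; nra].
  by exists u, w; split=> //; [lra|apply: le_trans len; rewrite hw; nra].
have [n nP] : exists n : nat, h y - h x < n%:R * (q - p).
  exists (Num.bound `|(h y - h x) / (q - p)|).
  rewrite -ltr_pdivrMr ?subr_gt0//; apply: le_lt_trans (ler_norm _) _.
  exact/archi_boundP.
have [u [v [Iu Iv puv len]]] := bisect n; exists v => //.
have len2 : (n%:R : R) <= 2 ^+ n by rewrite -natrX ler_nat ltnW// ltn_expl.
have : (h v - h u) * 2 ^+ n < (q - p) * 2 ^+ n.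
  apply: le_lt_trans len (lt_le_trans nP _).
  by rewrite mulrC ler_wpM2l// subr_ge0 ltW.
by rewrite ltr_pM2r ?exprn_gt0//; lra.
Qed.

(** A missing value [w] would be skipped by a jump of [h] at the supremum of
    the points where [h] is at most [w], but density of the image fills it. *)
Lemma midpoint_image_interval : is_interval I -> is_interval (h @` I).
Proof.
move=> I_itv; apply/is_intervalPlt => _ _ [x Ix <-] [y Iy <-] w /andP[xw wy].
pose S := [set z | I z /\ h z <= w].
have Sx : S x by split=> //; exact: ltW.
have S_lt z z' : S z -> I z' -> w < h z' -> z < z'.
  by move=> [Iz zw] Iz' wz'; apply: h_lt => //; exact: le_lt_trans wz'.
have supS : has_sup S by split; [exists x|exists y => z Sz; exact/ltW/S_lt].
have Ic : I (sup S).
  apply: (I_itv x y) => //; rewrite sup_upper_bound//=.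
  by apply: ge_sup => [|z Sz]; [exists x|exact/ltW/S_lt].
exists (sup S) => //; case: (ltgtP (h (sup S)) w) => // hw.
  have xc : h x <= h (sup S) by apply: h_le; rewrite ?inE//; exact: sup_upper_bound.
  have [|z Iz /andP[cz zw]] := midpoint_image_dense Ix Iy _ hw.
    by rewrite xc (lt_trans hw).
  have := h_lt Ic Iz cz; rewrite ltNge sup_upper_bound//; split=> //; exact: ltW.
have [|z Iz /andP[wz zc]] := midpoint_image_dense Ix Iy _ hw.
  by rewrite ltW.
have := h_lt Iz Ic zc; rewrite ltNge ge_sup//; first by exists x.
by move=> z' Sz'; exact/ltW/S_lt.
Qed.

End MonotoneFunctions.

(** Each interval would contain a rational, different ones for different [t],
    although [0, 1] is uncountable. *)
Lemma no_disjoint_intervals {R : realType} (l r : R -> R) :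
  (forall t : R, 0 <= t <= 1 -> l t < r t) ->
  (forall t t' : R, 0 <= t -> t < t' -> t' <= 1 -> r t <= l t') -> False.
Proof.
move=> lr disj.
have /choice[q qP] : forall t : R, exists q : rat, 0 <= t <= 1 -> l t < ratr q < r t.
  move=> t; have [t01|] := boolP (0 <= t <= 1); last by exists 0.
  by have /rat_in_itvoo[q] := lr t t01; rewrite in_itv/= => qP; exists q.
have q_lt t t' : 0 <= t -> t < t' -> t' <= 1 -> (ratr (q t) : R) < ratr (q t').
  move=> t0 tt' t'1; have := qP t ltac:(lra); have := qP t' ltac:(lra).
  by have := disj t t' t0 tt' t'1; lra.
have : countable `[(0 : R), 1].
  apply/countable_injP; exists (pickle \o q) => t t'.
  rewrite !inE /= !in_itv/= => t01 t'01 /(pcan_inj pickleK) qtt'.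
  case: (ltgtP t t') => // tt'.
    by have := q_lt t t' ltac:(lra) tt' ltac:(lra); rewrite qtt' ltxx.
  by have := q_lt t' t ltac:(lra) tt' ltac:(lra); rewrite qtt' ltxx.
move/countable_lebesgue_measure0; rewrite lebesgue_measure_itv/= lte_fin ltr01.
by rewrite oppr0 adde0 => /eqP; rewrite onee_eq0.
Qed.

(** * Comparing lists by their means *)

Section ListMeans.
Context {R : realType} (I : set R) (M : forall n : nat, 'rV[R]_n -> R).
Context (M_mean : forall n : nat, (0 < n)%N -> is_mean I (M n))
  (M_symmetric : forall n : nat, (0 < n)%N -> symmetric_on I (M n))
  (M_increasing : forall n : nat, (0 < n)%N -> strictly_increasing_each I (M n))
  (M_replacement : replacement_axiom I M).

Local Set Implicit Arguments.
Local Unset Strict Implicit.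
Implicit Types s t c : seq R.
Local Notation inI := (all (mem I)).

(** Lists carry the concatenations and permutations of the proof without casts
    between dimensions. *)
Definition list_mean s : R := M (size s) (\row_(i < size s) s`_i).

Let cube_row s n : inI s -> size s = n -> cube I n (\row_(i < n) s`_i).
Proof.
move=> Is sn i; rewrite mxE; apply/set_mem.
by apply: (allP Is); rewrite mem_nth// sn.
Qed.

Lemma list_mean_mem s : s != [::] -> inI s -> I (list_mean s).
Proof.
move=> s0 Is; have s_gt0 : (0 < size s)%N by rewrite lt0n size_eq0.
have [M_fun _] := M_mean _ s_gt0; exact/M_fun/cube_row.
Qed.

Lemma list_mean_itv s u v : s != [::] -> inI s ->
  {in s, forall x, u <= x <= v} -> u <= list_mean s <= v.
Proof.
move=> s0 Is s_uv; have s_gt0 : (0 < size s)%N by rewrite lt0n size_eq0.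
have row_uv i : u <= (\row_(i < size s) s`_i) ord0 i <= v.
  by rewrite mxE; apply/s_uv/mem_nth.
have [_ /(_ _ (cube_row Is erefl) (Ordinal s_gt0)) /andP[minM Mmax]] :=
  M_mean _ s_gt0.
apply/andP; split.
  apply: le_trans minM; apply: le_bigmin => [|i _].
    by have /andP[] := row_uv (Ordinal s_gt0).
  by have /andP[] := row_uv i.
apply: le_trans Mmax _; apply: bigmax_le => [|i _].
  by have /andP[] := row_uv (Ordinal s_gt0).
by have /andP[] := row_uv i.
Qed.

Lemma list_mean_nseq n x : I x -> list_mean (nseq n.+1 x) = x.
Proof.
move=> Ix; apply/le_anti; rewrite andbC; apply: list_mean_itv => //.
  by rewrite all_nseq/= mem_set.
by move=> y /nseqP[-> _]; rewrite lexx.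
Qed.

Lemma list_mean_perm s t : inI s -> perm_eq s t -> list_mean s = list_mean t.
Proof.
move=> Is st; have It : inI t by rewrite -(perm_all _ st).
have [t0|t_gt0] := posnP (size t).
  by move: st; rewrite (size0nil t0) => /perm_nilP ->.
have [p sE] := tuple_permP (t := in_tuple t) st.
rewrite /list_mean (perm_size st) -(M_symmetric _ t_gt0 _ (cube_row It erefl) p).
congr M; apply/rowP => i; rewrite !mxE /= sE.
rewrite (nth_map i) ?size_enum_ord// nth_ord_enum.
by rewrite (tnth_nth 0).
Qed.

(** The replacement axiom, extended to empty lists: replacing the whole list is
    idempotency. *)
Lemma list_mean_cat s t : inI s -> inI t ->
  list_mean (s ++ t) = list_mean (nseq (size s) (list_mean s) ++ t).
Proof.
move=> Is It; case: s Is => [//|x s] Is.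
have Ims : I (list_mean (x :: s)) by exact: list_mean_mem.
case: t It => [|y t] It; first by rewrite !cats0 list_mean_nseq.
have cat_row s1 t1 : \row_(i < size s1 + size t1) (s1 ++ t1)`_i =
    row_mx (\row_(i < size s1) s1`_i) (\row_(i < size t1) t1`_i).
  apply/rowP => i; rewrite mxE; case: (split_ordP i) => j -> /=.
    by rewrite row_mxEl mxE nth_cat ltn_ord.
  by rewrite row_mxEr mxE nth_cat ltnNge leq_addr/= addKn.
rewrite {1 2}/list_mean !size_cat !cat_row size_nseq.
rewrite (M_replacement _ _ _ _ _ _ (cube_row Is erefl) (cube_row It erefl))//.
by congr (M _ (row_mx _ _)); apply/rowP => i; rewrite !mxE nth_nseq ltn_ord.
Qed.

Let list_mean_cons_lt x y c : I x -> I y -> inI c -> x < y ->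
  list_mean (x :: c) < list_mean (y :: c).
Proof.
move=> Ix Iy Ic xy; have Ixc : inI (x :: c) by rewrite /= mem_set.
have consE z : replace_coord (\row_(i < size (x :: c)) (x :: c)`_i) ord0 z =
    \row_(i < size (z :: c)) (z :: c)`_i.
  by apply/rowP => i; rewrite !mxE -val_eqE; case: i => [[|i] ?].
have := M_increasing _ (ltn0Sn (size c)) _ (cube_row Ixc erefl) ord0.
by move=> /(_ x y (mem_set Ix) (mem_set Iy) xy); rewrite !consE.
Qed.

Let list_mean_nseq_lt n x y c : I x -> I y -> inI c -> x < y ->
  list_mean (nseq n.+1 x ++ c) < list_mean (nseq n.+1 y ++ c).
Proof.
move=> Ix Iy + xy; elim: n c => [|n IH] c Ic; first exact: list_mean_cons_lt.
have Iyc : inI (y :: c) by rewrite /= mem_set.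
apply: lt_trans (_ : _ < list_mean (y :: nseq n.+1 x ++ c)) _.
  have Ixc : inI (nseq n.+1 x ++ c) by rewrite all_cat Ic all_nseq /= mem_set.
  exact: list_mean_cons_lt.
have perm_y z : I z ->
    list_mean (nseq n.+1 z ++ y :: c) = list_mean (y :: nseq n.+1 z ++ c).
  move=> Iz; apply: list_mean_perm; last exact: permEl (perm_catCA _ [:: y] c).
  by rewrite all_cat Iyc all_nseq /= mem_set.
by rewrite -!perm_y//; exact: IH.
Qed.

(** By replacement [s] and [t] may be taken constant, equal to their means; then
    the arguments are increased one at a time. *)
Lemma list_mean_catr_lt s t c : inI s -> inI t -> inI c -> size s = size t ->
  list_mean s < list_mean t -> list_mean (s ++ c) < list_mean (t ++ c).
Proof.
move=> Is It Ic st; rewrite [X in _ -> X < _]list_mean_cat//.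
rewrite [X in _ -> _ < X]list_mean_cat// -st; case: s t Is It st => [|x s] [|y t]//; first by rewrite ltxx.
move=> Is It _ lt_st; apply: list_mean_nseq_lt => //; exact: list_mean_mem.
Qed.

Lemma list_mean_catr_le s t c : inI s -> inI t -> inI c -> size s = size t ->
  (list_mean (s ++ c) <= list_mean (t ++ c)) = (list_mean s <= list_mean t).
Proof.
move=> Is It Ic st; case: (ltgtP (list_mean s) (list_mean t)) => [lt_st|lt_ts|eq_st].
- by rewrite ltW// list_mean_catr_lt.
- by rewrite leNgt list_mean_catr_lt.
by rewrite list_mean_cat// [leRHS]list_mean_cat// eq_st st lexx.
Qed.

(** * The preordered group of formal differences of lists *)

(** The formal sum of the entries of [s] in the free abelian group on the real
    line, encoded by its coefficients. *)
Definition formal_sum s : R -> int := fun x => (count_mem x s)%:Z.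
Definition point x := formal_sum [:: x].

(** Identities between combinations of formal sums hold coefficientwise. *)
Local Ltac formal_ring :=
  apply/funext => ?; rewrite ?(natmulfctE, fctE) /=; ring.

(** The combinations of points of [I] of degree 0. *)
Definition balanced (f : R -> int) := exists s t,
  [/\ inI s, inI t, size s = size t & f = formal_sum s - formal_sum t].

(** The positive cone: existence of one representation with ordered means; by
    [nonneg_formal_sum], all representations then agree. *)
Definition nonneg (f : R -> int) := exists s t,
  [/\ inI s, inI t, size s = size t, list_mean t <= list_mean s &
      f = formal_sum s - formal_sum t].

Let formal_sum_cat s t : formal_sum (s ++ t) = formal_sum s + formal_sum t.
Proof. by apply/funext => x; rewrite /formal_sum count_cat PoszD. Qed.

Let formal_sum_cons x s : formal_sum (x :: s) = point x + formal_sum s.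
Proof. by rewrite -cat1s formal_sum_cat. Qed.

Let formal_sum_nseq n x : formal_sum (nseq n x) = point x *+ n.
Proof.
elim: n => [|n IH]; first by rewrite mulr0n.
by rewrite mulrS -IH -formal_sum_cons.
Qed.

Let formal_sum_inj s t : formal_sum s = formal_sum t -> perm_eq s t.
Proof.
by move=> st; apply/allP => x _ /=; move/(congr1 (@^~ x)): st => [->].
Qed.

Lemma nonneg_balanced f : nonneg f -> balanced f.
Proof. by move=> [s [t [Is It st _ ->]]]; exists s, t. Qed.

(** Two representations [s - t = s' - t'] make [s ++ t'] a permutation of
    [s' ++ t], so the comparisons of [s] with [t] and of [s'] with [t'] agree
    after adding [t'] to the first pair and [t] to the second. *)
Lemma nonneg_formal_sum s t : inI s -> inI t -> size s = size t ->
  nonneg (formal_sum s - formal_sum t) <-> list_mean t <= list_mean s.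
Proof.
move=> Is It st; split=> [[s' [t' [Is' It' st' le_ts' E]]]|]; last by exists s, t.
have st_perm : perm_eq (s ++ t') (s' ++ t).
  apply: formal_sum_inj; rewrite !formal_sum_cat.
  by apply/funext => x; move/(congr1 (@^~ x)): E; rewrite !fctE; lia.
rewrite -(list_mean_catr_le It Is It')// (list_mean_perm _ st_perm) ?all_cat ?Is//.
rewrite -(list_mean_catr_le It' Is' It)// in le_ts'.
by rewrite (list_mean_perm (t := t' ++ t)) ?all_cat ?It// perm_catC.
Qed.

Lemma nonneg_point x y : I x -> I y -> nonneg (point y - point x) <-> x <= y.
Proof.
move=> Ix Iy; rewrite nonneg_formal_sum//= ?mem_set//.
by rewrite -[ [:: x] ]/(nseq 1 x) -[ [:: y] ]/(nseq 1 y) !list_mean_nseq.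
Qed.

Lemma balancedN f : balanced f -> balanced (- f).
Proof. by move=> [s [t [Is It st ->]]]; exists t, s; split=> //; rewrite opprB. Qed.

Lemma balancedD f g : balanced f -> balanced g -> balanced (f + g).
Proof.
move=> [s [t [Is It st ->]]] [s' [t' [Is' It' st' ->]]].
exists (s ++ s'), (t ++ t'); rewrite !all_cat Is It !size_cat st st'; split=> //.
by rewrite !formal_sum_cat; formal_ring.
Qed.

Lemma nonnegD f g : nonneg f -> nonneg g -> nonneg (f + g).
Proof.
move=> [s [t [Is It st ts ->]]] [s' [t' [Is' It' st' ts' ->]]].
exists (s ++ s'), (t ++ t'); rewrite !all_cat Is It !size_cat st st'; split=> //.
  apply: (@le_trans _ _ (list_mean (s ++ t'))); first by rewrite list_mean_catr_le.
  have swap u : inI u -> list_mean (s ++ u) = list_mean (u ++ s).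
    by move=> Iu; apply: list_mean_perm; rewrite ?all_cat ?Is// perm_catC.
  by rewrite !swap// list_mean_catr_le.
by rewrite !formal_sum_cat; formal_ring.
Qed.

Lemma nonneg_total f : balanced f -> nonneg f \/ nonneg (- f).
Proof.
move=> [s [t [Is It st ->]]]; rewrite opprB.
by case: (leP (list_mean t) (list_mean s)) => [ts|/ltW ts];
  [left; exists s, t|right; exists t, s].
Qed.

Let nonneg_muln f n : nonneg f -> nonneg (f *+ n).
Proof.
move=> Nf; elim: n => [|n IH]; last by rewrite mulrS; exact: nonnegD.
by exists [::], [::]; split=> //; rewrite mulr0n subrr.
Qed.

(** Both lists have the same mean, by idempotency; this is how every element of
    the group reduces to a multiple of a difference of two points. *)
Lemma nonneg_list_mean s : inI s ->
  nonneg (formal_sum s - point (list_mean s) *+ size s) /\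
  nonneg (point (list_mean s) *+ size s - formal_sum s).
Proof.
move=> Is; rewrite -formal_sum_nseq.
have Ims : inI (nseq (size s) (list_mean s)).
  rewrite all_nseq; case: s Is => //= x s Is; rewrite mem_set ?orbT//.
  exact: list_mean_mem.
have mE : list_mean (nseq (size s) (list_mean s)) = list_mean s.
  case: s Is {Ims} => // x s Is; exact/list_mean_nseq/list_mean_mem.
by split; apply/nonneg_formal_sum; rewrite ?size_nseq ?mE.
Qed.

Let point_balanced x y : I x -> I y -> balanced (point y - point x).
Proof. by move=> Ix Iy; exists [:: y], [:: x]; rewrite /= !mem_set. Qed.

Let balanced_muln f n : balanced f -> balanced (f *+ n).
Proof.
move=> Bf; elim: n => [|n IH]; last by rewrite mulrS; exact: balancedD.
by exists [::], [::]; split=> //; rewrite mulr0n subrr.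
Qed.

(** * The group is archimedean *)

Context (I_interval : is_interval I).

(** If [d] is infinitesimal relative to [v - u], then a chain of points indexed
    by the real interval [0, 1] has all its steps larger than [d]: the points
    at which the additive map normalized by [v - u], and vanishing on [d], takes
    the values [t]. *)
Lemma coarse_chain d u v : I u -> I v -> u < v -> nonneg d ->
  (forall n, nonneg (point v - point u - d *+ n)) ->
  exists c : R -> R, (forall t : R, 0 <= t <= 1 -> I (c t)) /\
    forall t t' : R, 0 <= t -> t < t' -> t' <= 1 ->
      ~ nonneg (d - (point (c t') - point (c t))).
Proof.
move=> Iu Iv uv Nd d_small; have Bd := nonneg_balanced Nd; pose e := point v - point u.
have Be : balanced e by exact: point_balanced.
have Ne : nonneg e by apply/nonneg_point => //; exact: ltW.
(* Multiples of [v - u] need not bound the whole group, hence the restriction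
   to the convex subgroup that they generate. *)
pose D f := balanced f /\ exists n, nonneg (e *+ n - f) /\ nonneg (e *+ n + f).
have D_opp f : D f -> D (- f).
  move=> [Bf [n [Nn Nn']]]; split; first exact: balancedN.
  by exists n; rewrite opprK.
have D_add f g : D f -> D g -> D (f + g).
  move=> [Bf [n [Nn Nn']]] [Bg [k [Nk Nk']]]; split; first exact: balancedD.
  exists (n + k)%N; split.
    have -> : e *+ (n + k) - (f + g) = (e *+ n - f) + (e *+ k - g) by formal_ring.
    exact: nonnegD.
  have -> : e *+ (n + k) + (f + g) = (e *+ n + f) + (e *+ k + g) by formal_ring.
  exact: nonnegD.
have D_sub f g : D f -> D g -> D (f - g) by move=> Df Dg; apply/D_add/D_opp.
have D_le f : balanced f -> nonneg f -> nonneg (e - f) -> D f.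
  by move=> Bf Nf Nef; split=> //; exists 1%N; split=> //; exact: nonnegD.
have De : D e by apply: D_le => //; exists [::], [::]; rewrite !subrr.
have Dd : D d by apply: D_le => //; exact: (d_small 1%N).
have [F [F_add F_opp F_muln F_ge0 F_e]] : exists F : (R -> int) -> R,
    [/\ forall f g, D f -> D g -> F (f + g) = F f + F g,
        forall f, D f -> F (- f) = - F f,
        forall f n, D f -> F (f *+ n) = F f *+ n,
        forall f, D f -> nonneg f -> 0 <= F f
      & F e = 1].
  apply: hoelder => //; first exact: nonnegD.
  - by move=> f [Bf _]; exact: nonneg_total.
  - by rewrite /e opprB => /nonneg_point; rewrite leNgt uv => /(_ Iv Iu).
  - by move=> f [_ [n [Nn _]]]; exists n.
have F_sub f g : D f -> D g -> F (f - g) = F f - F g.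
  by move=> Df Dg; rewrite F_add ?F_opp//; exact: D_opp.
(* All multiples of [d] stay below [e], whose image is 1. *)
have Fd : F d = 0.
  apply/le_anti; rewrite F_ge0// andbT leNgt; apply/negP => Fd.
  have /archi_boundP : 0 <= (F d)^-1 by rewrite invr_ge0 ltW.
  set n := Num.bound _; rewrite -(ltr_pM2l Fd) mulfV ?gt_eqF// ltNge.
  have Ddn : D (d *+ n).
    elim: (n) => [|k IH]; last by rewrite mulrS; exact: D_add.
    by rewrite mulr0n -(subrr e); exact: D_sub.
  rewrite mulr_natr -F_muln// -F_e -subr_ge0 -F_sub// F_ge0//; exact: D_sub.
pose S := [set z | I z /\ u <= z <= v].
pose h z := F (point z - point u).
have S_D z : S z -> D (point z - point u).
  move=> [Iz /andP[uz zv]]; apply: D_le; first exact: point_balanced.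
    exact/nonneg_point.
  have -> : e - (point z - point u) = point v - point z by rewrite /e; formal_ring.
  exact/nonneg_point.
have S_B z z' : S z -> S z' ->
    D (point z' - point z) /\ F (point z' - point z) = h z' - h z.
  move=> /S_D Dz /S_D Dz'; rewrite -F_sub//.
  have -> : point z' - point z = (point z' - point u) - (point z - point u).
    by formal_ring.
  by split=> //; exact: D_sub.
have h_le : {in S &, {homo h : z z' / z <= z'}}.
  move=> z z' /set_mem Sz /set_mem Sz' zz'; have [Dzz' Fzz'] := S_B _ _ Sz Sz'.
  by rewrite -subr_ge0 -Fzz' F_ge0//; apply/nonneg_point => //; [case: Sz|case: Sz'].
(* The mean of [z] and [z'] is their midpoint in the group. *)
have h_mid z z' : S z -> S z' -> exists2 w, S w & h w = (h z + h z') / 2.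
  move=> Sz Sz'; have [[Iz uzv] [Iz' uzv']] := (Sz, Sz').
  have Izz' : inI [:: z; z'] by rewrite /= !mem_set.
  have Sw : S (list_mean [:: z; z']).
    split; first exact: list_mean_mem.
    by apply: list_mean_itv => // w; rewrite !inE => /orP[/eqP->|/eqP->].
  have [N1 N2] := nonneg_list_mean Izz'; set w := list_mean _ in Sw N1 N2.
  exists w => //; have [Dz Fz] := S_B _ _ Sw Sz; have [Dz' Fz'] := S_B _ _ Sw Sz'.
  have E : formal_sum [:: z; z'] - point w *+ 2 =
      (point z - point w) + (point z' - point w).
    by rewrite formal_sum_cons; formal_ring.
  have Dzz' := D_add _ _ Dz Dz'.
  have := F_ge0 _ Dzz'; rewrite -{1}E => /(_ N1); rewrite F_add// Fz Fz'.
  have := F_ge0 _ (D_opp _ Dzz'); rewrite -{1}E opprB => /(_ N2).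
  by rewrite F_opp// F_add// Fz Fz'; lra.
have S_itv : is_interval S.
  move=> z z' [Iz uzv] [Iz' uzv'] w wzz'; split; first exact: I_interval wzz'.
  by lra.
have Su : S u by rewrite /S /= lexx ltW.
have Sv : S v by rewrite /S /= lexx ltW.
have hu : h u = 0 by rewrite /h subrr -(subrr e) F_sub ?subrr.
have hv : h v = 1 by rewrite /h -F_e.
have hS_itv := midpoint_image_interval h_le h_mid S_itv.
have /choice[c cP] : forall t : R, exists z, 0 <= t <= 1 -> S z /\ h z = t.
  move=> t; have [t01|] := boolP (0 <= t <= 1); last by exists 0.
  have [|||z Sz hz] := hS_itv (h u) (h v) _ _ t; [by exists u|by exists v| |].
    by rewrite hu hv.
  by exists z.
exists c; split=> [t t01|t t' t0 tt' t'1]; first by have [[]] := cP t t01.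
have [St ht] := cP t ltac:(lra); have [St' ht'] := cP t' ltac:(lra).
have [Dt Ft] := S_B _ _ St St' => Nd'; have := F_ge0 _ (D_sub _ _ Dd Dt) Nd'.
by rewrite F_sub// Fd Ft ht ht'; lra.
Qed.

(** Otherwise the intervals between the means of [c t, x] and [c t, y], with [c]
    the chain of [coarse_chain], are nonempty and pairwise disjoint. *)
Lemma archimedean x y u v : I x -> I y -> I u -> I v -> x < y -> u < v ->
  exists n, nonneg ((point y - point x) *+ n - (point v - point u)).
Proof.
move=> Ix Iy Iu Iv xy uv; apply: contrapT => no_n.
pose d := point y - point x.
have Bd : balanced d by exact: point_balanced.
have [||c [Ic c_gap]] := @coarse_chain d u v Iu Iv uv.
- by apply/nonneg_point => //; exact: ltW.
- move=> n; have : balanced (d *+ n - (point v - point u)).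
    by apply: balancedD; [exact: balanced_muln|exact/balancedN/point_balanced].
  by case/nonneg_total => [Nn|]; [case: no_n; exists n|rewrite opprB].
apply: (no_disjoint_intervals (fun t : R => list_mean [:: c t; x])
  (fun t : R => list_mean [:: c t; y])) => [t t01|t t' t0 tt' t'1].
  have Ict := Ic t t01; rewrite ltNge; apply/negP.
  rewrite -nonneg_formal_sum/= ?mem_set//.
  have -> : formal_sum [:: c t; x] - formal_sum [:: c t; y] = point x - point y.
    by rewrite !formal_sum_cons; formal_ring.
  by rewrite nonneg_point// leNgt xy.
have Ict : I (c t) by apply: Ic; lra.
have Ict' : I (c t') by apply: Ic; lra.
rewrite leNgt; apply/negP => /ltW; rewrite -nonneg_formal_sum/= ?mem_set//.
have -> : formal_sum [:: c t; y] - formal_sum [:: c t'; x] =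
    d - (point (c t') - point (c t)).
  by rewrite !formal_sum_cons /d; formal_ring.
exact: c_gap.
Qed.

(** * The generator *)

(** For [phi x := F (x - a)] with [F] the map of [hoelder] and unit [b - a], the
    sum over [s] is the value of [F] at [s - n a], which is equivalent to
    [n (m - a)] where [m] is the mean of [s]. Strict monotonicity is where the
    archimedean property enters: some multiple of [y - x] exceeds the unit. *)
Lemma quasi_arithmetic_generator : nondegenerate I -> exists phi : R -> R,
  {in I &, {homo phi : x y / x < y}} /\
  forall s, s != [::] -> inI s ->
    \sum_(x <- s) phi x = phi (list_mean s) *+ size s.
Proof.
move=> I_nondeg.
have [a [b [Ia Ib ab]]] : exists a b, [/\ I a, I b & a < b].
  have [x [y [Ix Iy]]] := I_nondeg; rewrite neq_lt => /orP[xy|yx].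
    by exists x, y.
  by exists y, x.
pose e := point b - point a.
have Be : balanced e by exact: point_balanced.
(* A difference of lists of length [m] is equivalent to [m] times the difference
   of their means, which the archimedean property bounds. *)
have e_unit f : balanced f -> exists n, nonneg (e *+ n - f).
  move=> [s [t [Is It st ->]]]; case: s t Is It st => [|x s] [|y t]// Is It st.
    by exists 0%N, [::], [::]; split=> //; rewrite mulr0n subrr subr0.
  have [ts|st_lt] := leP (list_mean (x :: s)) (list_mean (y :: t)).
    by exists 0%N; rewrite mulr0n sub0r opprB; exact/nonneg_formal_sum.
  have Ims : I (list_mean (x :: s)) by exact: list_mean_mem.
  have Imt : I (list_mean (y :: t)) by exact: list_mean_mem.
  have [k Nk] := archimedean Ia Ib Imt Ims ab st_lt.
  have [_ Ns] := nonneg_list_mean Is; have [Nt _] := nonneg_list_mean It.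
  exists (k * size (x :: s))%N; rewrite -st in Nt.
  set m := size _ in Ns Nt *; set p := list_mean _ in Nk Ns.
  set q := list_mean _ in Nk Nt.
  have -> : e *+ (k * m) - (formal_sum (x :: s) - formal_sum (y :: t)) =
      (e *+ k - (point p - point q)) *+ m + (point p *+ m - formal_sum (x :: s)) +
      (formal_sum (y :: t) - point q *+ m).
    by formal_ring.
  by apply: nonnegD => //; apply: nonnegD => //; exact: nonneg_muln.
have [F [F_add F_opp F_muln F_ge0 F_e]] : exists F : (R -> int) -> R,
    [/\ forall f g, balanced f -> balanced g -> F (f + g) = F f + F g,
        forall f, balanced f -> F (- f) = - F f,
        forall f n, balanced f -> F (f *+ n) = F f *+ n,
        forall f, balanced f -> nonneg f -> 0 <= F f
      & F e = 1].
  apply: hoelder => //.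
  - exact: balancedN.
  - exact: balancedD.
  - exact: nonnegD.
  - exact: nonneg_total.
  by rewrite /e opprB => /nonneg_point; rewrite leNgt ab => /(_ Ib Ia).
have F_sub f g : balanced f -> balanced g -> F (f - g) = F f - F g.
  by move=> Bf Bg; rewrite F_add ?F_opp//; exact: balancedN.
pose phi x := F (point x - point a).
have phi_sub x y : I x -> I y -> phi y - phi x = F (point y - point x).
  move=> Ix Iy; rewrite -F_sub; [|exact: point_balanced..].
  by congr F; formal_ring.
exists phi; split=> [x y /set_mem Ix /set_mem Iy xy|s s0 Is].
  have [n Nn] := archimedean Ix Iy Ia Ib xy ab.
  rewrite -subr_gt0 phi_sub// lt_neqAle F_ge0 ?andbT//; last 2 first.
  - exact: point_balanced.
  - by apply/nonneg_point => //; exact: ltW.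
  have Bxy := point_balanced Ix Iy.
  have Bn : balanced ((point y - point x) *+ n - e).
    by apply: balancedD; [exact: balanced_muln|exact: balancedN].
  have := F_ge0 _ Bn Nn; rewrite (F_sub (_ *+ n))//; last exact: balanced_muln.
  rewrite F_muln// F_e; by case: eqP => // <-; rewrite mul0rn sub0r oppr_ge0 ler10.
have sum_phi t : inI t -> balanced (formal_sum t - point a *+ size t) /\
    \sum_(x <- t) phi x = F (formal_sum t - point a *+ size t).
  elim: t => [_|x t IH /andP[/set_mem Ix /IH[Bt sum_t]]].
    have -> : formal_sum [::] - point a *+ size (@nil R) = e *+ 0.
      by rewrite !mulr0n subr0.
    by rewrite big_nil F_muln//; split=> //; exact: balanced_muln.
  have -> : formal_sum (x :: t) - point a *+ size (x :: t) =
      (point x - point a) + (formal_sum t - point a *+ size t).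
    by rewrite formal_sum_cons /= mulrS; formal_ring.
  rewrite big_cons sum_t [RHS]F_add//; last exact: point_balanced.
  by split=> //; apply: balancedD => //; exact: point_balanced.
have Im := list_mean_mem s0 Is; have [N1 N2] := nonneg_list_mean Is.
have [Bs ->] := sum_phi s Is; set m := list_mean s in Im N1 N2 *.
have Bm : balanced (point m - point a) by exact: point_balanced.
have E : formal_sum s - point m *+ size s =
    (formal_sum s - point a *+ size s) - (point m - point a) *+ size s.
  by formal_ring.
have B1 : balanced (formal_sum s - point m *+ size s) by exact: nonneg_balanced.
have B2 : balanced (point m *+ size s - formal_sum s) by exact: nonneg_balanced.
rewrite /phi -F_muln//; apply/eqP.
rewrite -subr_eq0 -F_sub//; last exact: balanced_muln.
rewrite -E eq_le F_ge0// andbT -oppr_ge0 -F_opp// opprB; exact: F_ge0.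
Qed.

End ListMeans.

(** * Continuity and conclusion *)

Lemma within_continuous_comp_within {T U W : topologicalType} (A : set T)
    (B : set U) (f : T -> U) (g : U -> W) : set_fun A B f ->
  {within A, continuous f} -> {within B, continuous g} ->
  {within A, continuous (g \o f)}.
Proof.
move=> fAB /subspace_continuousP f_cont /subspace_continuousP g_cont.
apply/subspace_continuousP => x Ax; apply: cvg_comp (g_cont _ (fAB _ Ax)).
move=> V /(f_cont _ Ax); apply: filterS2 (withinT _ _) => y Ay /= BV.
exact/BV/fAB.
Qed.

Theorem theorem1p2 (R : realType) (I : set R) (M : forall n : nat, 'rV[R]_n -> R)
  (I_interval : is_interval I) (I_nondegenerate : nondegenerate I)
  (M_mean : forall n : nat, (0 < n)%N -> is_mean I (M n))
  (M_symmetric : forall n : nat, (0 < n)%N -> symmetric_on I (M n))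
  (M_1 : forall x : 'rV[R]_1, cube I 1 x -> M 1%N x = x ord0 ord0)
  (M_increasing : forall n : nat, (0 < n)%N -> strictly_increasing_each I (M n))
  (M_replacement : replacement_axiom I M) :
  (exists (J : set R) (phi : R -> R),
    [/\ is_interval J /\ nondegenerate J,
        {within I, continuous phi},
        strictly_monotone_on I phi,
        set_bij I J phi
      & forall n : nat, (0 < n)%N -> forall x : 'rV[R]_n, cube I n x ->
          M n x =
            'pinv_(fun=> 0) I phi ((\sum_(i < n) phi (x ord0 i)) / n%:R)]) /\
  (forall n : nat, (0 < n)%N -> {within cube I n, continuous (M n)}).
Proof.
have [phi [phi_lt phi_sum]] := quasi_arithmetic_generator M_mean M_symmetric
  M_increasing M_replacement I_interval I_nondegenerate.
have phi_inj : {in I &, injective phi}.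
  move=> x y Ix Iy pxy; case: (ltgtP x y) => // xy.
    by have := phi_lt _ _ Ix Iy xy; rewrite pxy ltxx.
  by have := phi_lt _ _ Iy Ix xy; rewrite pxy ltxx.
have phi_le : {in I &, {homo phi : x y / x <= y}}.
  move=> x y Ix Iy; rewrite le_eqVlt => /orP[/eqP->//|xy].
  exact/ltW/phi_lt.
pose J := phi @` I; pose psi := 'pinv_(fun=> 0) I phi.
have phiK x : I x -> psi (phi x) = x.
  by move=> Ix; apply: pinvKV => //; exact: mem_set.
have phi_avg n (x : 'rV[R]_n) : (0 < n)%N -> cube I n x -> I (M n x) /\
    phi (M n x) = (\sum_(i < n) phi (x ord0 i)) / n%:R.
  move=> n_gt0 Ix; have Im : I (M n x).
    by have [M_fun _] := M_mean n n_gt0; exact: M_fun.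
  split=> //; pose s := [seq x ord0 i | i <- enum 'I_n].
  have s_size : size s = n by rewrite size_map size_enum_ord.
  have s_mean : list_mean M s = M n x.
    rewrite /list_mean s_size; congr M; apply/rowP => i.
    by rewrite mxE (nth_map i) ?size_enum_ord// nth_ord_enum.
  have Is : all (mem I) s by apply/allP => _ /mapP[i _ ->]; exact/mem_set/Ix.
  have s0 : s != [::] by rewrite -size_eq0 s_size -lt0n.
  have := phi_sum s s0 Is; rewrite s_mean s_size big_map big_enum/= => ->.
  by rewrite -(mulr_natr (phi _)) mulfK// pnatr_eq0 -lt0n.
have J_interval : is_interval J.
  apply: midpoint_image_interval phi_le _ I_interval => x y Ix Iy.
  pose xy : 'rV[R]_2 := \row_i [:: x; y]`_i.
  have Ixy : cube I 2 xy by move=> i; rewrite mxE; case: i => [[|[]]].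
  have [Im phi_m] := phi_avg 2 xy isT Ixy; exists (M 2 xy) => //.
  by rewrite phi_m !big_ord_recl big_ord0 !mxE addr0.
have phi_cont : {within I, continuous phi} by exact: interval_image_continuous.
have psi_le : {in J &, {homo psi : x y / x <= y}}.
  move=> _ _ /set_mem[x Ix <-] /set_mem[y Iy <-]; rewrite !phiK//.
  by apply: contraTT; rewrite -!ltNge; apply: phi_lt; exact: mem_set.
have psi_cont : {within J, continuous psi}.
  apply: interval_image_continuous => //.
  suff -> : psi @` J = I by [].
  apply/seteqP; split=> [_ [_ [x Ix <-] <-]|x Ix]; first by rewrite phiK.
  by exists (phi x); [exists x|exact: phiK].
split; last first.
  move=> n n_gt0.
  pose avg (x : 'rV[R]_n) := (\sum_(i < n) phi (x ord0 i)) / n%:R.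
  have avg_J : set_fun (cube I n) J avg.
    by move=> x Ix; have [Im phi_m] := phi_avg n x n_gt0 Ix; exists (M n x).
  have avg_cont : {within cube I n, continuous avg}.
    have coord_cont (i : 'I_n) :
        {within cube I n, continuous (fun x => phi (x ord0 i))}.
      apply: (within_continuous_comp_within _ I (fun x : 'rV_n => x ord0 i)) => //.
      by apply: continuous_subspaceT; exact: coord_continuous.
    move=> x; apply: cvgMr_tmp; move: x.
    apply: (continuous_big (op := +%R)) => [|i _]; first exact: add_continuous.
    exact: coord_cont.
  have := within_continuous_comp_within _ _ _ _ avg_J avg_cont psi_cont.
  apply: subspace_eq_continuous => x /set_mem Ix.
  have [Im phi_m] := phi_avg n x n_gt0 Ix.
  by rewrite /from_subspace /= /avg -phi_m phiK.
exists J, phi; split=> //.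
- split=> //; have [x [y [Ix Iy xy]]] := I_nondegenerate.
  exists (phi x), (phi y); split; [by exists x|by exists y|].
  by apply: contra_neq xy; apply: phi_inj; exact: mem_set.
- by left.
- by split=> // x Ix; exists x.
by move=> n n_gt0 x Ix; have [Im <-] := phi_avg n x n_gt0 Ix; rewrite [RHS]phiK.
Qed.
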